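(* Let $n\ge1$, let $\Omega$ be a subset of $\mathbb{R}^n$, and suppose that $\delta\in(0,n]$. If $(f_i)$ is an increasing sequence of non-negative functions $f_i:\Omega\to[0,\infty]$ (that is, $f_i(x)\le f_{i+1}(x)$ for all $i$ and all $x\in\Omega$; no measurability is assumed) and $f(x)=\lim_{i\to\infty}f_i(x)$ for every $x\in\Omega$, then $$\lim_{i\to\infty}\int_\Omega f_i\,d\tilde{\mathcal H}^\delta_\infty=\int_\Omega f\,d\tilde{\mathcal H}^\delta_\infty.$$
   Context: Dyadic cubes: for $k\in\mathbb{Z}$ let $\mathcal Q_k$ be the collection of half-open cubes $Q$ with vertices in the lattice $(2^k\mathbb{Z})^n$, each a translate of $[0,2^k)^n$; its side length is $\ell(Q)=2^k$. Dyadic cubes are the elements of $\bigcup_{k\in\mathbb{Z}}\mathcal Q_k$. Dyadic Hausdorff content: for $\delta\in(0,n]$ and any $E\subset\mathbb{R}^n$, $\tilde{\mathcal H}^\delta_\infty(E):=\inf\{\sum_{i}\ell(Q_i)^\delta : E\subset \operatorname{int}(\bigcup_{i}Q_i)\}$, the infimum being over all countable (or finite) collections of dyadic cubes $Q_i$. Choquet integral: for any set $\Omega\subset\mathbb{R}^n$ and any function $f:\Omega\to[0,\infty]$ (no measurability required), $\int_\Omega f\,d\tilde{\mathcal H}^\delta_\infty:=\int_0^\infty\tilde{\mathcal H}^\delta_\infty(\{x\in\Omega: f(x)>t\})\,dt$. *)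

(* Defs.v *)
From mathcomp Require Import all_boot all_order all_algebra.
From mathcomp Require Import all_classical all_reals all_analysis.
Import Order.TTheory GRing.Theory Num.Theory.
Import numFieldNormedType.Exports.
Set Implicit Arguments.
Unset Strict Implicit.
Unset Printing Implicit Defensive.

Local Open Scope classical_set_scope.
Local Open Scope ring_scope.

(* [(k, m)] stands for the cube 2^k (m + [0, 1)^n). For 0 < n this
   encoding is a bijection onto the dyadic cubes of R^n. *)
Definition dyadic (n : nat) : Type := (int * 'rV[int]_n)%type.

Definition side (R : realType) (n : nat) (Q : dyadic n) : R := 2 ^ Q.1.

Definition cube (R : realType) (n : nat) (Q : dyadic n) : set 'rV[R]_n :=
  [set x : 'rV[R]_n | forall j : 'I_n,
     side R Q * (Q.2 ord0 j)%:~R <= x ord0 j < side R Q * (Q.2 ord0 j + 1)%:~R].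

(* A countable or finite collection is a family indexed by a subset [D] of nat;
   [°] is the interior in R^n. *)
Definition dyadic_content (R : realType) (n : nat) (delta : R)
    (E : set 'rV[R]_n) : \bar R :=
  ereal_inf [set s | exists (D : set nat) (Q : nat -> dyadic n),
    E `<=` (\bigcup_(i in D) @cube R n (Q i))° /\
    s = (\esum_(i in D) (side R (Q i) `^ delta)%:E)%E].

(* Only the values of [f] on [Omega] matter. The integrand is nonincreasing in
   [t] and nonnegative, so its Lebesgue integral is always meaningful. *)
Definition choquet (R : realType) (n : nat) (delta : R)
    (Omega : set 'rV[R]_n) (f : 'rV[R]_n -> \bar R) : \bar R :=
  (\int[lebesgue_measure]_(t in `[0%R, +oo[)
     dyadic_content delta [set x | Omega x /\ (t%:E < f x)%E])%E.

(* Main.v *)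
(* Two dyadic cubes are nested or disjoint, which makes the content strongly
   subadditive and continuous along increasing sequences of arbitrary sets:
   choose covers [G m] of [E m] that are optimal up to [e / 2^(m+1)]. If [F m]
   is the family of maximal cubes of [G 0], ..., [G m], strong subadditivity
   shows inductively that the cost of [F m] exceeds the content of [E m] by at
   most [e]. The maximal cubes of all the [G m] cover the union of the [E m],
   and each finite set of them lies in some [F m], so their cost is at most
   the limit of the contents plus [e]. Applied to the superlevel sets of the
   [f_ i], this reduces the theorem to monotone convergence for the
   nonincreasing integrands. *)
Require Import Defs.
From mathcomp Require Import all_boot all_order all_algebra.
From mathcomp Require Import all_classical all_reals all_analysis.
From mathcomp Require Import measurable_realfun lra.
Import Order.TTheory GRing.Theory Num.Theory.
Import numFieldNormedType.Exports.
Local Open Scope classical_set_scope.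
Local Open Scope ring_scope.

(** * Sums over arbitrary index sets *)

Lemma esum_subset (R : realType) (T : choiceType) (A B : set T)
    (a : T -> \bar R) :
  A `<=` B -> (\esum_(x in A) a x <= \esum_(x in B) a x)%E.
Proof.
move=> AB; apply: ge_ereal_sup => _ [X [finX XA] <-].
by apply: ereal_sup_ubound; exists X => //; split => // x /XA/AB.
Qed.

Lemma esum_setU_le (R : realType) (T : choiceType) (A B : set T)
    (a : T -> \bar R) (a_ge0 : forall x, (0 <= a x)%E) :
  (\esum_(x in A `|` B) a x <= \esum_(x in A) a x + \esum_(x in B) a x)%E.
Proof.
rewrite (esumID A) //; apply: leeD; apply: esum_subset => // x [] //.
by move=> [].
Qed.

(** Repeated values only add terms: a section [s] of [e] selects one index in [D] for each value. *)
Lemma esum_image_le (R : realType) (T T' : choiceType) (D : set T)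
    (e : T -> T') (a : T' -> \bar R) :
  (\esum_(y in e @` D) a y <= \esum_(x in D) a (e x))%E.
Proof.
have [->|/set0P[x0 Dx0]] := eqVneq D set0.
  by rewrite image_set0 !esum_set0.
have [s sP] : {s : T' -> T &
    forall y, (e @` D) y -> D (s y) /\ e (s y) = y}.
  apply: (@choice _ _ (fun y x => (e @` D) y -> D x /\ e x = y)) => y.
  by case: (pselect ((e @` D) y)) => [[x Dx <-]|?]; [exists x|exists x0].
rewrite (_ : \esum_(y in e @` D) a y = \esum_(y in e @` D) a (e (s y)))%E.
  rewrite -(esum_image (e @` D) s (fun x => a (e x))); last first.
    move=> y z /set_mem/sP[_ ey] /set_mem/sP[_ ez] eq_s.
    by rewrite -ey -ez eq_s.
  by apply: esum_subset => // _ [y /sP[Ds _] <-].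
by apply: eq_esum => y /sP[_ ->].
Qed.

(** A finite subset of the union of a chain lies in a single [S m], and the sum is the supremum of
    its finite partial sums. *)
Lemma esum_bigcup_le (R : realType) (T : choiceType) (S : nat -> set T)
    (a : T -> \bar R) (c : \bar R) :
  (forall i j, (i <= j)%N -> S i `<=` S j) ->
  (forall i, (\esum_(x in S i) a x <= c)%E) ->
  (\esum_(x in \bigcup_i S i) a x <= c)%E.
Proof.
move=> homoS Sc; apply: ge_ereal_sup => _ [X [finX XS] <-].
suff [m XSm] : exists m, X `<=` S m.
  by apply: le_trans (Sc m); apply: ereal_sup_ubound; exists X.
have [Y XY] := (finite_seqP _).1 finX; rewrite XY in XS *.
have [i iP] : {i : T -> nat & forall x, x \in Y -> S (i x) x}.
  apply: (@choice _ _ (fun x k => x \in Y -> S k x)) => x.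
  case: (boolP (x \in Y)) => [xY|_]; last by exists 0%N.
  by have [k _ Sk] := XS x xY; exists k.
exists (\max_(x <- Y) i x)%N => x /= xY.
by apply: homoS (iP x xY); exact: leq_bigmax_seq.
Qed.

(** * Dyadic cubes: nesting and maximal cubes *)

Section families.
Context (R : realType) (n : nat) (delta : R) (delta_gt0 : 0 < delta).
Implicit Types (Q P : dyadic n) (F G : set (dyadic n)).

Definition weight Q : \bar R := (side R Q `^ delta)%:E.

Definition cost F : \bar R := \esum_(Q in F) weight Q.

Definition cubes F : set 'rV[R]_n := \bigcup_(Q in F) @cube R n Q.

(** Comparing generations keeps this relation antisymmetric even for [n = 0], where all cubes are
    the same point. *)
Definition subcube Q P := Q.1 <= P.1 /\ @cube R n Q `<=` @cube R n P.

Definition maxcubes F :=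
  [set Q | F Q /\ forall P, F P -> subcube Q P -> Q = P].

Lemma weight_ge0 Q : (0 <= weight Q)%E.
Proof. by rewrite lee_fin powR_ge0. Qed.

Lemma cost_subset F G : F `<=` G -> (cost F <= cost G)%E.
Proof. exact: esum_subset. Qed.

Lemma weight_le_cost F Q : F Q -> (weight Q <= cost F)%E.
Proof.
move=> FQ; rewrite -(esum_set1 (weight_ge0 Q)).
by apply: esum_subset => _ ->.
Qed.

Lemma side_gt0 Q : 0 < side R Q.
Proof. by rewrite exprz_gt0. Qed.

Lemma cube_nonempty Q : @cube R n Q !=set0.
Proof.
exists (\row_j (side R Q * (Q.2 ord0 j)%:~R)) => j; rewrite !mxE lexx /=.
by rewrite ltr_pM2l ?side_gt0// ltr_int ltrDl.
Qed.

Lemma cube_nested Q P x :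
  Q.1 <= P.1 -> cube Q x -> @cube R n P x -> subcube Q P.
Proof.
move=> leQP Qx Px; split => // y Qy j.
have [d dE] : exists d : nat, P.1 = Q.1 + d%:Z.
  by exists `|P.1 - Q.1|%N; rewrite gez0_abs ?subr_ge0// subrKC.
have sE : side R P = side R Q * (2 ^+ d)%:~R.
  by rewrite /side dE expfzDr ?pnatr_eq0// rmorphXn.
have s0 := side_gt0 Q.
have /andP[qx xq] := Qx j; have /andP[px xp] := Px j.
have /andP[qy yq] := Qy j.
move: px xp; rewrite sE -!mulrA -!intrM => px xp.
(* The common point [x] gives strict inequalities between integers, which sharpen to comparisons of
   the endpoints in units of [side R Q]. *)
have h1 : 2 ^+ d * P.2 ord0 j <= Q.2 ord0 j.
  by rewrite -ltzD1 -(ltr_int R) -(ltr_pM2l s0) (le_lt_trans px).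
have h2 : Q.2 ord0 j + 1 <= 2 ^+ d * (P.2 ord0 j + 1).
  by rewrite lezD1 -(ltr_int R) -(ltr_pM2l s0) (le_lt_trans qx).
apply/andP; split.
  by apply: le_trans qy; rewrite ler_pM2l// ler_int.
by apply: lt_le_trans yq _; rewrite ler_pM2l// ler_int.
Qed.

Lemma cube_eq Q P x : Q.1 = P.1 -> cube Q x -> @cube R n P x -> Q = P.
Proof.
move=> eQP Qx Px; case: Q P eQP Qx Px => [k q] [l p] /= -> Qx Px.
congr (_, _); apply/rowP => j; apply/eqP; rewrite eq_le.
have s0 := side_gt0 (l, p).
have /andP[qx xq] := Qx j; have /andP[px xp] := Px j.
by apply/andP; split; rewrite -ltzD1 -(ltr_int R) -(ltr_pM2l s0);
  [exact: le_lt_trans qx xp | exact: le_lt_trans px xq].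
Qed.

Lemma subcube_trans P Q Q' : subcube Q P -> subcube P Q' -> subcube Q Q'.
Proof.
by move=> [h1 s1] [h2 s2]; split; [exact: le_trans h2 | exact: subset_trans s2].
Qed.

Lemma subcube_lt Q P : subcube Q P -> Q <> P -> Q.1 < P.1.
Proof.
move=> [leQP sQP] neqQP; rewrite lt_neqAle leQP andbT; apply/eqP => eQP.
have [x Qx] := cube_nonempty Q.
by apply: neqQP; apply: (cube_eq _ _ x) => //; exact: sQP.
Qed.

(** A cube that is not maximal lies in a member of strictly larger generation. This climb stops
    below [K]; the induction is on a bound for the number of generations left. *)
Lemma maxcubes_above F (K : int) Q : (forall P, F P -> P.1 <= K) -> F Q ->
  exists2 P, maxcubes F P & subcube Q P.
Proof.
move=> FK FQ.
have larger P : F P -> ~ maxcubes F P ->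
    exists P', [/\ F P', subcube P P' & P.1 < P'.1].
  move=> FP nmP; apply: contrapT => nP'; apply: nmP; split => // P' FP' PP'.
  apply: contrapT => neqPP'; apply: nP'; exists P'; split => //.
  exact: subcube_lt.
have [d] : exists d : nat, K <= Q.1 + d%:Z.
  by exists `|K - Q.1|%N; rewrite -lerBlDl; exact: lez_abs.
elim: d Q FQ => [|d IH] Q FQ Kd;
  (have [mQ|/(larger _ FQ)[P [FP QP ltQP]]] := pselect (maxcubes F Q);
    first by exists Q => //; split).
  have := lt_le_trans ltQP (FK _ FP).
  by rewrite ltNge -[X in _ <= X]addr0 Kd.
have [//||P' mP' PP'] := IH P.
  by apply: le_trans Kd _; rewrite intS addrA lerD2r lezD1.
by exists P' => //; exact: subcube_trans PP'.
Qed.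

Lemma cubes_maxcubes F (K : int) : (forall P, F P -> P.1 <= K) ->
  cubes (maxcubes F) = cubes F.
Proof.
move=> FK; apply/seteqP; split => x [Q FQ Qx].
  by exists Q => //; case: FQ.
have [P mP [_ QP]] := maxcubes_above _ _ _ FK FQ.
by exists P => //; exact: QP.
Qed.

(** Since [delta] is positive, a bound on the weight bounds the side, and m < 2^m then bounds the
    generation. Covers of bounded cost thus have maximal cubes. *)
Lemma weight_bounded (c : R) :
  exists K : int, forall Q, (weight Q <= c%:E)%E -> Q.1 <= K.
Proof.
exists (Num.bound (c `^ delta^-1)) => -[k q]; rewrite lee_fin /side/= => wc.
case: k wc => // m wc; rewrite lez_nat -(ler_nat R) ltW//.
have c_ge0 : 0 <= c := le_trans (powR_ge0 _ _) wc.
apply: le_lt_trans (archi_boundP (powR_ge0 _ _)).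
have : ((2 ^ m%:Z) `^ delta) `^ delta^-1 <= c `^ delta^-1.
  by apply: ge0_ler_powR => //; rewrite ?nnegrE ?powR_ge0// invr_ge0 ltW.
rewrite -powRrM mulfV ?gt_eqF// powRr1 ?exprz_ge0//; apply: le_trans.
by rewrite -exprnP -natrX ler_nat ltnW// ltn_expl.
Qed.

(* [meet A G] collects the cubes of [maxcubes A] and of [G] that [maxcubes]
   may discard when [G] is added to [A]; they still cover the intersection. *)
Definition meet A G :=
  [set Q | maxcubes A Q /\ exists2 P, G P & subcube Q P] `|`
  [set Q | G Q /\ exists2 P, maxcubes A P & subcube Q P /\ Q <> P].

(** Strong subadditivity at the level of covers. The parts of [maxcubes A] in [X] and of [G] in [Y]
    pay for [meet A G]; the remaining parts contain [maxcubes (A]|[G)]. Of a cube in both families,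
    the copy in [maxcubes A] goes to [meet] and the copy in [G] remains. *)
Lemma cost_maxcubesU_meet A G :
  (cost (maxcubes (A `|` G)) + cost (meet A G) <= cost (maxcubes A) + cost G)%E.
Proof.
pose X := [set Q | exists2 P, G P & subcube Q P].
pose Y := [set Q | exists2 P, maxcubes A P & subcube Q P /\ Q <> P].
have costID F Z : cost F = (cost (F `&` Z) + cost (F `&` ~` Z))%E.
  by apply: esumID => Q _; exact: weight_ge0.
rewrite (costID (maxcubes A) X) (costID G Y) addeACA addeC.
apply: leeD; last exact: (esum_setU_le _ _ _ _ _ weight_ge0).
apply: le_trans (esum_setU_le _ _ _ _ _ weight_ge0); apply: cost_subset.
move=> Q [AGQ maxQ].
case: (pselect (maxcubes A Q /\ ~ X Q)) => [?|nQ]; [by left|right].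
have GQ : G Q.
  apply: contrapT => nGQ; apply: nQ; split.
    by split=> [|P AP QP]; [case: AGQ | apply: maxQ => //; left].
  by move=> [P GP QP]; apply: nGQ; rewrite (maxQ P)//; right.
by split => // -[P [AP _] [QP]]; apply; apply: maxQ => //; left.
Qed.

(** Two cubes with a common point are nested, and the smaller one belongs to [meet A G]; for equal
    generations it is the cube of [maxcubes A]. *)
Lemma cubes_meet A G : cubes (maxcubes A) `&` cubes G `<=` cubes (meet A G).
Proof.
move=> x [[Q AQ Qx] [P GP Px]].
have [leQP|ltPQ] := lerP Q.1 P.1.
  exists Q => //; left; split => //; exists P => //; exact: (cube_nested _ _ x).
exists P => //; right; split => //; exists Q => //; split.
  by apply: (cube_nested _ _ x) => //; exact: ltW.
by move=> eQP; rewrite eQP ltxx in ltPQ.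
Qed.

(** * The content and its continuity along increasing sequences *)

Lemma content_ge0 (E : set 'rV[R]_n) : (0 <= dyadic_content delta E)%E.
Proof.
apply: le_ereal_inf_tmp => _ [D [Q [_ ->]]].
by apply: esum_ge0 => i _; exact: weight_ge0.
Qed.

Lemma content_subset (E E' : set 'rV[R]_n) : E `<=` E' ->
  (dyadic_content delta E <= dyadic_content delta E')%E.
Proof.
move=> EE'; apply: le_ereal_inf => s [D [Q [E'Q ->]]].
by exists D, Q; split => //; exact: subset_trans E'Q.
Qed.

Lemma content_le_cost (E : set 'rV[R]_n) F : E `<=` (cubes F)° ->
  (dyadic_content delta E <= cost F)%E.
Proof.
move=> EF; pose T : countType := (int * 'rV[int]_n)%type.
(* There are countably many cubes, so [F] is indexed by the codes of its members; the default cube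
   sits only at numbers that code no cube. *)
pose Q i : T := odflt (0, 0) (unpickle i).
have QK (q : T) : Q (pickle q) = q by rewrite /Q pickleK.
apply: ereal_inf_lbound; exists (@pickle T @` F), Q; split.
  rewrite (_ : \bigcup_(i in _) _ = cubes F)//.
  rewrite bigcup_image; apply: eq_bigcupr => q _; by rewrite QK.
rewrite esum_image; last by move=> ? ? _ _; exact: (pcan_inj pickleK).
by apply: eq_esum => q _; rewrite QK.
Qed.

Lemma content_lt_cost (E : set 'rV[R]_n) c : (dyadic_content delta E < c)%E ->
  exists2 F, E `<=` (cubes F)° & (cost F < c)%E.
Proof.
move=> /ereal_inf_lt[_ [D [Q [EQ ->]]] ltc]; exists (Q @` D).
  by rewrite /cubes bigcup_image.
by apply: le_lt_trans ltc; exact: esum_image_le.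
Qed.

Lemma content_bigcup_le (E : nat -> set 'rV[R]_n) (c : R) :
  (forall i, E i `<=` E i.+1) ->
  (forall i, (dyadic_content delta (E i) <= c%:E)%E) ->
  (dyadic_content delta (\bigcup_i E i) <= c%:E)%E.
Proof.
move=> incE Ec; apply/lee_addgt0Pr => e e0.
pose h i := fine (dyadic_content delta (E i)).
have hE i : dyadic_content delta (E i) = (h i)%:E.
  rewrite fineK// ge0_fin_numE ?content_ge0//; exact: le_lt_trans (ltry c).
pose eps i := e * 2 ^- i.+1.
have eps0 i : 0 < eps i by rewrite mulr_gt0// invr_gt0 exprn_gt0.
have epsS i : eps i = eps i.+1 + eps i.+1.
  by rewrite -mulr2n -mulr_natr -mulrA [in RHS]exprSr invfM divfK.
have [G GP] : {G : nat -> set (dyadic n) & forall i,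
    E i `<=` (cubes (G i))° /\ (cost (G i) < (h i + eps i)%:E)%E}.
  apply: (@choice _ _ (fun i F =>
    E i `<=` (cubes F)° /\ (cost F < (h i + eps i)%:E)%E)) => i.
  have [|F EF Fc] := content_lt_cost (E i) (h i + eps i)%:E; last by exists F.
  by rewrite hE lte_fin ltrDl.
have epsle i : eps i <= e.
  by rewrite ler_piMr// ?(ltW e0)// invf_le1 ?exprn_gt0// exprn_ege1// ler1n.
(* All the covers cost at most [c + e], so one bound on generations serves every family below. *)
have [K GK] : exists K : int, forall i Q, G i Q -> Q.1 <= K.
  have [K KP] := weight_bounded (c + e); exists K => i Q GQ; apply: KP.
  apply: le_trans (weight_le_cost _ _ GQ) _.
  apply: le_trans (ltW (GP i).2) _; rewrite lee_fin lerD//.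
  by rewrite -lee_fin -hE.
pose A m := \bigcup_(i in [set i | (i <= m)%N]) G i.
have AK m P : A m P -> P.1 <= K by move=> [i _]; exact: GK.
have AS m : A m.+1 = A m `|` G m.+1.
  apply/seteqP; split => [Q [i /= im GQ]|Q [[i /= im GQ]|GQ]].
  - move: im; rewrite leq_eqVlt => /orP[/eqP eim|im]; last by left; exists i.
    by right; rewrite -eim.
  - by exists i => //=; exact: leqW.
  - by exists m.+1 => /=.
(* The errors e/2 + ... + e/2^(m+1) allowed so far add up to [e - eps m]. *)
have costA m : (cost (maxcubes (A m)) <= (h m + e - eps m)%:E)%E.
  elim: m => [|m IH].
    apply: (@le_trans _ _ (cost (G 0%N))).
      apply: cost_subset => Q [[i /=]]; rewrite leqn0 => /eqP -> //.
    apply: le_trans (ltW (GP 0%N).2) _; rewrite lee_fin.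
    by rewrite -addrA lerD2l lerBrDr [X in _ <= X]splitr /eps expr1.
  (* As [E m] lies in [E m.+1], it is interior to both covers, hence to their intersection. Its
     content, a lower bound for the cost of [meet], cancels the [h m] of the induction
     hypothesis. *)
  have EM : (dyadic_content delta (E m) <= cost (meet (A m) (G m.+1)))%E.
    apply: content_le_cost.
    apply: (@subset_trans _ (cubes (maxcubes (A m)) `&` cubes (G m.+1))°).
      rewrite interiorI (cubes_maxcubes _ _ (AK m)) => x Ex; split.
        have := (GP m).1 _ Ex; apply: interiorS => y [Q GQ Qy].
        by exists Q => //; exists m => /=.
      by apply: (GP m.+1).1; exact: incE.
    by apply: interiorS; exact: cubes_meet.
  have := cost_maxcubesU_meet (A m) (G m.+1); rewrite -AS => cM.
  have {}cM := le_trans (leeD (lexx _) EM) cM.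
  have {}cM := le_trans cM (leeD IH (ltW (GP m.+1).2)).
  rewrite hE -EFinD -leeBrDr// -EFinB in cM.
  apply: le_trans cM _; rewrite lee_fin; have := epsS m; lra.
pose U := \bigcup_i G i.
have UK P : U P -> P.1 <= K by move=> [i _]; exact: GK.
apply: (@le_trans _ _ (cost (maxcubes U))).
  apply: content_le_cost; rewrite (cubes_maxcubes _ _ UK) => x [i _ Ex].
  have := (GP i).1 _ Ex; apply: interiorS => y [Q GQ Qy].
  by exists Q => //; exists i.
(* A cube of [A m] that is maximal in [U] is maximal in [A m], so [costA] bounds the cost of each
   [S m]. *)
pose S m := maxcubes U `&` A m.
apply: (@le_trans _ _ (cost (\bigcup_m S m))).
  apply: cost_subset => Q mQ; have [[i _ GQ] _] := mQ.
  by exists i => //; split => //; exists i => /=.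
apply: esum_bigcup_le => [i j ij Q [mQ [k /= ki GQ]]|m].
  by split => //; exists k => //=; exact: leq_trans ij.
apply: (@le_trans _ _ (cost (maxcubes (A m)))).
  apply: cost_subset => Q [[_ maxQ] AQ]; split => // P [k _ GP'].
  by apply: maxQ; exists k.
apply: le_trans (costA m) _; rewrite -EFinD lee_fin.
have := Ec m; rewrite hE lee_fin; have := eps0 m; lra.
Qed.

Lemma content_cvg (E : nat -> set 'rV[R]_n) : (forall i, E i `<=` E i.+1) ->
  dyadic_content delta (E i) @[i --> \oo] -->
  dyadic_content delta (\bigcup_i E i).
Proof.
move=> incE.
have nd : {homo (fun i => dyadic_content delta (E i)) :
    i j / (i <= j)%N >-> (i <= j)%E}.
  by apply/nondecreasing_seqP => i; exact: content_subset.
rewrite [X in _ --> X](_ : _ =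
    ereal_sup (range (fun i => dyadic_content delta (E i)))).
  exact: ereal_nondecreasing_cvgn.
apply/eqP; rewrite eq_le; apply/andP; split; last first.
  apply: ge_ereal_sup => _ [i _ <-]; apply: content_subset.
  by move=> x Ex; exists i.
set s := ereal_sup _.
have le_s i : (dyadic_content delta (E i) <= s)%E.
  by apply: ereal_sup_ubound; exists i.
case: s le_s => [c| |] le_s; [exact: content_bigcup_le| exact: leey|].
by have := le_trans (content_ge0 (E 0%N)) (le_s 0%N).
Qed.

End families.

(** * Passage to the Choquet integral *)

Lemma nonincreasing_emeasurable (R : realType) (D : set R) (f : R -> \bar R) :
  measurable D -> {homo f : s t / (t <= s)%R >-> (s <= t)%E} ->
  measurable_fun D f.
Proof.
move=> mD f_ni.
apply: (measurability _ (ErealGenCInfty.measurableE R)) => // _ [_ [r ->] <-].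
(* By monotonicity the preimage of a ray [r, +oo] is an interval. *)
apply: measurableI => //; apply: is_interval_measurable => s t/=.
rewrite !in_itv/= !andbT => fs ft u /andP[su ut].
by rewrite in_itv/= andbT (le_trans ft)// f_ni.
Qed.

Theorem proposition4p1 (R : realType) (n : nat) (hn : (1 <= n)%N)
    (Omega : set 'rV[R]_n) (delta : R) (hdelta : 0 < delta <= n%:R)
    (f_ : nat -> 'rV[R]_n -> \bar R) (f : 'rV[R]_n -> \bar R)
    (f_ge0 : forall i x, Omega x -> (0 <= f_ i x)%E)
    (f_incr : forall i x, Omega x -> (f_ i x <= f_ i.+1 x)%E)
    (f_lim : forall x, Omega x -> f_ i x @[i --> \oo] --> f x) :
  choquet delta Omega (f_ i) @[i --> \oo] --> choquet delta Omega f.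
Proof.
have /andP[delta_gt0 _] := hdelta.
pose E i (t : R) := [set x | Omega x /\ (t%:E < f_ i x)%E].
have incE t i : E i t `<=` E i.+1 t.
  by move=> x [Ox tf]; split => //; exact: lt_le_trans (f_incr _ _ Ox).
have fE x : Omega x -> f x = ereal_sup (range (f_ ^~ x)).
  move=> Ox; apply: (cvg_unique _ (f_lim x Ox)) => //.
  apply: ereal_nondecreasing_cvgn.
  by apply/nondecreasing_seqP => i; exact: f_incr.
(* The strict inequality matters: a number below the supremum of the [f_ i x] is below one of
   them. *)
have limE t : \bigcup_i E i t = [set x | Omega x /\ (t%:E < f x)%E].
  apply/seteqP; split => [x [i _ [Ox tf]]|x [Ox]].
    split => //; apply: lt_le_trans tf _; rewrite fE//.
    by apply: ereal_sup_ubound; exists i.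
  by rewrite fE// => /ereal_sup_gt[_ [i _ <-] tf]; exists i.
pose h i t := dyadic_content delta (E i t).
have mh i : measurable_fun (`[0%R, +oo[%classic : set R) (h i).
  apply: nonincreasing_emeasurable => // s t st.
  apply: content_subset => x [Ox tf]; split => //.
  by apply: le_lt_trans tf; rewrite lee_fin.
have h_ge0 i t : (`[0%R, +oo[%classic : set R) t -> (0 <= h i t)%E.
  by move=> _; exact: content_ge0.
have h_nd t : (`[0%R, +oo[%classic : set R) t ->
    {homo h ^~ t : i j / (i <= j)%N >-> (i <= j)%E}.
  by move=> _; apply/nondecreasing_seqP => i; exact: content_subset.
have choquetE : choquet delta Omega f =
    (\int[lebesgue_measure]_(t in `[0%R, +oo[) limn (h ^~ t))%E.
  apply: eq_integral => t _; apply/esym/cvg_lim => //.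
  by rewrite -limE; exact: content_cvg.
rewrite choquetE.
exact (@cvg_monotone_convergence _ _ _ lebesgue_measure _
  (measurable_itv _) _ mh h_ge0 h_nd).
Qed.
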